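(* Let $(X,\phi)$ be a non-compact, connected calibrated manifold. The following two conditions are equivalent. 1) $K\subset\subset X\Rightarrow\widehat K\subset\subset X$, and $X$ carries a strictly $\phi$-plurisubharmonic function. 2) There exists a strictly $\phi$-plurisubharmonic proper exhaustion function for $X$.
   Context: A calibrated manifold $(X,\phi)$ of degree $p\ge 1$ is a smooth riemannian manifold $X$ together with a closed smooth $p$-form $\phi$ such that $\phi(\xi)\le 1$ for every unit simple tangent $p$-vector $\xi$ on $X$. $G(\phi)$ denotes the set of unit simple tangent $p$-vectors $\xi$ with $\phi(\xi)=1$ ($\phi$-planes). For $f\in C^\infty(X)$, the $\phi$-Hessian of $f$ is the $p$-form $\mathcal H^\phi(f)(v_1,\dots,v_p)=\sum_{i=1}^p\phi(v_1,\dots,\nabla_{v_i}(\nabla f),\dots,v_p)$ ($\nabla_{v_i}(\nabla f)$ in the $i$-th slot, $\nabla$ the Levi-Civita connection). $f$ is $\phi$-plurisubharmonic if $\mathcal H^\phi(f)(\xi)\ge 0$ for all $\xi\in G(\phi)$, and strictly $\phi$-plurisubharmonic if $\mathcal H^\phi(f)(\xi)>0$ for all $\xi\in G(\phi)$. $\mathcal{PSH}(X,\phi)$ is the set of all smooth $\phi$-plurisubharmonic functions. For a compact set $K\subset X$, the $(X,\phi)$-convex hull is $\widehat K=\{x\in X: f(x)\le\sup_K f\ \text{for all } f\in\mathcal{PSH}(X,\phi)\}$. The notation $A\subset\subset X$ means that $A$ has compact closure in $X$; the implication in 1) is to be read for all compact $K\subset X$. A proper exhaustion function is a function $f:X\to\mathbb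 R$ such that $\{x\in X: f(x)\le c\}$ is compact for every $c\in\mathbb R$. *)

(* Defs.v *)
From HB Require Import structures.
From mathcomp Require Import all_boot all_order all_algebra.
From mathcomp Require Import all_classical all_reals all_analysis.
Set Implicit Arguments.
Unset Strict Implicit.
Unset Printing Implicit Defensive.
Import Order.TTheory GRing.Theory Num.Theory.
Import numFieldNormedType.Exports.
Local Open Scope classical_set_scope.
Local Open Scope ring_scope.

(* All tensors are written in local coordinates.  A tangent vector at a point
   is a row vector of components in a chart, a p-tuple (v_1, ..., v_p) of
   tangent vectors is the matrix 'M_(p, n) with rows v_1, ..., v_p, and the
   simple p-vector v_1 /\ ... /\ v_p is represented by that same matrix (every
   simple p-vector is of this form, and alternating multilinear functions only
   depend on the product).  Since 'D_v f a = v *m 'J f a, a change of chart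
   tau maps the components V to V *m 'J tau y. *)

Section Local.
Context {R : realType}.

(* Meant for open U: continuity and derivatives are those of the total
   function f at the points of U. *)
Fixpoint Ck_on {V W : normedModType R} (k : nat) (U : set V) (f : V -> W) :
    Prop :=
  match k with
  | 0 => forall x, U x -> {for x, continuous f}
  | k'.+1 => (forall x, U x -> differentiable f x) /\
             (forall v, Ck_on k' U (fun x => 'D_v f x))
  end.

Definition smooth_on {V W : normedModType R} (U : set V) (f : V -> W) :=
  forall k, Ck_on k U f.

Context {n p : nat}.
Implicit Types (g : 'rV[R]_n -> 'M[R]_n) (y v : 'rV[R]_n) (f : 'rV[R]_n -> R).

Definition set_row (i : 'I_p) v (V : 'M[R]_(p, n)) : 'M[R]_(p, n) :=
  \matrix_(j < p) (if j == i then v else row j V).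

Definition alternating_multilinear (w : 'M[R]_(p, n) -> R) : Prop :=
  (forall (i : 'I_p) (a : R) u v V,
     w (set_row i (a *: u + v) V) = a * w (set_row i u V) + w (set_row i v V)) /\
  (forall (i j : 'I_p) V, i != j -> row i V = row j V -> w V = 0).

Definition inner (G : 'M[R]_n) (v w : 'rV[R]_n) : R := (v *m G *m w^T) 0 0.

(* |v_1 /\ ... /\ v_p|^2 = det (<v_i, v_j>) for the norm induced on p-vectors
   by the inner product G. *)
Definition unit_simple (G : 'M[R]_n) (V : 'M[R]_(p, n)) : Prop :=
  \det (\matrix_(i < p, j < p) inner G (row i V) (row j V)) = 1.

(* (dw)(v_0, ..., v_p) for vectors v_i extended as constant fields in the
   coordinates; the brackets [v_i, v_j] then vanish. *)
Definition ext_deriv (w : 'rV[R]_n -> 'M[R]_(p, n) -> R) y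
    (V : 'M[R]_(p.+1, n)) : R :=
  \sum_(i < p.+1) (-1) ^+ i * 'D_(row i V) (fun z => w z (row' i V)) y.

Definition vec_e (i : 'I_n) : 'rV[R]_n := delta_mx 0 i.

Definition grad g f y : 'rV[R]_n :=
  \row_(k < n) \sum_(l < n) invmx (g y) k l * 'D_(vec_e l) f y.

(* Gamma^k_{ij} for the Levi-Civita connection of g. *)
Definition christoffel g y (i j k : 'I_n) : R :=
  2^-1 * \sum_(l < n) invmx (g y) k l *
    ('D_(vec_e i) (fun z => g z j l) y + 'D_(vec_e j) (fun z => g z i l) y
     - 'D_(vec_e l) (fun z => g z i j) y).

(* (nabla_v W)(y) *)
Definition cov_deriv g (W : 'rV[R]_n -> 'rV[R]_n) y v : 'rV[R]_n :=
  'D_v W y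
  + \row_(k < n) \sum_(i < n) \sum_(j < n) christoffel g y i j k * v 0 i * W y 0 j.

Definition local_phi_hessian g (w : 'rV[R]_n -> 'M[R]_(p, n) -> R) f y
    (V : 'M[R]_(p, n)) : R :=
  \sum_(i < p) w y (set_row i (cov_deriv g (grad g f) y (row i V)) V).

End Local.

Record chart (R : realType) (n : nat) (X : topologicalType) := Chart {
  chart_dom : set X;
  chart_map :> X -> 'rV[R]_n;
  chart_inv : 'rV[R]_n -> X;
  chart_dom_open : open chart_dom;
  chart_im_open : open (chart_map @` chart_dom);
  chart_mapK : forall x, chart_dom x -> chart_inv (chart_map x) = x;
  chart_map_cont : {within chart_dom, continuous chart_map};
  chart_inv_cont : {within chart_map @` chart_dom, continuous chart_inv}
}.

Definition chart_im (R : realType) (n : nat) (X : topologicalType)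
  (c : chart R n X) : set 'rV[R]_n := c @` chart_dom c.

Definition transition (R : realType) (n : nat) (X : topologicalType)
  (c d : chart R n X) : 'rV[R]_n -> 'rV[R]_n := d \o chart_inv c.

Record smooth_manifold (R : realType) (n : nat) := SmoothManifold {
  carrier :> topologicalType;
  carrier_hausdorff : hausdorff_space carrier;
  carrier_second_countable : @second_countable carrier;
  atlas : set (chart R n carrier);
  atlas_cover : forall x : carrier, exists2 c, atlas c & chart_dom c x;
  atlas_smooth : forall c d, atlas c -> atlas d ->
    smooth_on (c @` (chart_dom c `&` chart_dom d)) (transition c d)
}.

(* metric c y is the matrix (g_ij) in the chart c at the point of
   coordinates y. *)
Record riemannian_manifold (R : realType) (n : nat) := RiemannianManifold {
  smooth_base :> smooth_manifold R n;
  metric : chart R n smooth_base -> 'rV[R]_n -> 'M[R]_n;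
  metric_smooth : forall c i j, atlas c ->
    smooth_on (chart_im c) (fun y => metric c y i j);
  metric_sym : forall c y, atlas c -> chart_im c y ->
    (metric c y)^T = metric c y;
  metric_pos : forall c y v, atlas c -> chart_im c y -> v != 0 ->
    0 < inner (metric c y) v v;
  metric_change : forall c d x v w, atlas c -> atlas d ->
    chart_dom c x -> chart_dom d x ->
    let J := 'J (transition c d) (c x) in
    inner (metric c (c x)) v w = inner (metric d (d x)) (v *m J) (w *m J)
}.

Record calibrated_manifold (R : realType) (n p : nat) := CalibratedManifold {
  riem_base :> riemannian_manifold R n;
  calib : chart R n riem_base -> 'rV[R]_n -> 'M[R]_(p, n) -> R;
  calib_alt : forall c y, atlas c -> chart_im c y ->
    alternating_multilinear (calib c y);
  calib_smooth : forall c V, atlas c ->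
    smooth_on (chart_im c) (fun y => calib c y V);
  calib_change : forall c d x V, atlas c -> atlas d ->
    chart_dom c x -> chart_dom d x ->
    calib c (c x) V = calib d (d x) (V *m 'J (transition c d) (c x));
  calib_closed : forall c y V, atlas c -> chart_im c y ->
    ext_deriv (calib c) y V = 0;
  calib_le1 : forall c y V, atlas c -> chart_im c y ->
    unit_simple (metric c y) V -> calib c y V <= 1
}.

Section PSH.
Context {R : realType} {n p : nat} (X : calibrated_manifold R n p).
Implicit Types (f : X -> R) (K : set X) (c : chart R n X).

Definition smooth_fun f : Prop :=
  forall c, atlas c -> smooth_on (chart_im c) (f \o chart_inv c).

(* V, in the chart c, is an element of G(phi) at x. *)
Definition phi_plane c (x : X) (V : 'M[R]_(p, n)) : Prop :=
  unit_simple (metric c (c x)) V /\ calib c (c x) V = 1.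

Definition phi_hessian f c (x : X) (V : 'M[R]_(p, n)) : R :=
  local_phi_hessian (metric c) (calib c) (f \o chart_inv c) (c x) V.

Definition phi_psh f : Prop :=
  smooth_fun f /\
  forall c x V, atlas c -> chart_dom c x -> phi_plane c x V ->
    0 <= phi_hessian f c x V.

Definition strictly_phi_psh f : Prop :=
  smooth_fun f /\
  forall c x V, atlas c -> chart_dom c x -> phi_plane c x V ->
    0 < phi_hessian f c x V.

(* ereal_sup gives sup_K f = -oo for K empty. *)
Definition phi_hull K : set X :=
  [set x | forall f, phi_psh f ->
     ((f x)%:E <= ereal_sup [set (f y)%:E | y in K])%E].

Definition relatively_compact (A : set X) : Prop := compact (closure A).

Definition proper_exhaustion f : Prop :=
  forall r : R, compact [set x | f x <= r].

End PSH.

(* Main.v *)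
Require Import Defs.
From HB Require Import structures.
From mathcomp Require Import all_boot all_order all_algebra.
From mathcomp Require Import all_classical all_reals all_analysis.
From mathcomp Require Import ring lra.
Set Implicit Arguments.
Unset Strict Implicit.
Unset Printing Implicit Defensive.
Import Order.TTheory GRing.Theory Num.Theory.
Import numFieldNormedType.Exports.
Local Open Scope classical_set_scope.
Local Open Scope ring_scope.

(** If [f] is a strictly plurisubharmonic proper exhaustion function, then the hull
of a compact set [K] lies in the compact sublevel set of [f] at the level of its
maximum on [K].

Conversely, suppose that hulls of compact sets are relatively compact.  The
manifold is locally compact and second countable, so there are compact sets
[K m] exhausting it such that the hull of [K m] lies in the interior of
[K m.+1] ([phi_convex_exhaustion]).  A point outside the hull of [K m] is
separated from [K m] by a plurisubharmonic function; post-composing with a smooth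
convex increasing function that vanishes on a half-line ([hinge]), and adding
finitely many such functions, gives a nonnegative plurisubharmonic function that
vanishes on [K m] and is larger than [m] on the compact shell between the
interior of [K m.+1] and [K m.+2] ([psh_bump_compact]).  The sum of these
functions over [m] is locally finite, hence plurisubharmonic, and proper
([psh_of_compact_hulls]).  It need not be strictly plurisubharmonic, and a given
strictly plurisubharmonic function [g] need not be bounded below; but [exp g] is
positive and still strict, so adding it yields both properties.

The geometric input is that plurisubharmonicity survives composition with convex
increasing functions [h].  The chain rule ([hessian_comp]) adds to [h'(f)] times
the Hessian of [f] the term [h''(f)] times the sum over [i] of
[df(v_i) phi(v_1, ..., grad f, ..., v_p)].  On a plane where the form attains
its maximum [1], replacing a tangent vector by a normal one makes the form
vanish ([first_cousin_principle]), so this sum is the squared length of the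
tangential part of the gradient ([trace_term_ge0]). *)

(** * Linear algebra: the first cousin principle *)

Section LinearAlgebra.
Context {R : realType} {n p : nat}.
Implicit Types (G : 'M[R]_n) (u N : 'rV[R]_n) (V : 'M[R]_(p, n)).
Implicit Types (w : 'M[R]_(p, n) -> R).

Lemma row_set_row i u V j :
  row j (set_row i u V) = if j == i then u else row j V.
Proof. by rewrite rowK. Qed.

Lemma set_row_row i V : set_row i (row i V) V = V.
Proof. by apply/row_matrixP => j; rewrite row_set_row; case: eqP => [->|]. Qed.

Definition gram G V : 'M[R]_p := V *m G *m V^T.

Lemma unit_simpleE G V : unit_simple G V = (\det (gram G V) = 1).
Proof.
rewrite /unit_simple; congr (\det _ = 1).
apply/matrixP => i j; rewrite !mxE /inner !mxE; apply: eq_bigr => k _.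
by rewrite -row_mul !mxE.
Qed.

Lemma innerE G u V i : inner G u (row i V) = (u *m G *m V^T) 0 i.
Proof. by rewrite /inner !mxE; apply: eq_bigr => k _; rewrite !mxE. Qed.

Lemma det_gram_scale G i s u V :
  \det (gram G (set_row i (s *: u) V)) =
  s ^+ 2 * \det (gram G (set_row i u V)).
Proof.
pose d : 'rV[R]_p := \row_j (if j == i then s else 1).
have -> : set_row i (s *: u) V = diag_mx d *m set_row i u V.
  apply/row_matrixP => j.
  rewrite row_mul row_diag_mx -scalemxAl -rowE !row_set_row mxE.
  by case: eqP; rewrite ?scale1r.
rewrite /gram trmx_mul tr_diag_mx -!mulmxA det_mulmx !mulmxA det_mulmx.
have -> : \det (diag_mx d) = s.
  rewrite det_diag (bigD1 i)//= big1 ?mxE ?eqxx ?mulr1// => j ji.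
  by rewrite mxE (negbTE ji).
by ring.
Qed.

Lemma det_add_delta (M : 'M[R]_p) i a :
  \det (M + a *: delta_mx i i) =
  \det M + a * \det (\matrix_(j < p) if j == i then delta_mx 0 i else row j M).
Proof.
rewrite -[\det M]mul1r; apply: (@determinant_multilinear _ _ _ _ _ i).
- rewrite rowK eqxx linearD linearZ/= scale1r.
  by rewrite [row i (delta_mx _ _)]rowE mul_delta_mx.
- apply/matrixP => j k; rewrite !mxE.
  by rewrite [lift i j == i]eq_sym (negbTE (neq_lift _ _))/= mulr0 addr0.
- apply/matrixP => j k; rewrite !mxE.
  by rewrite [lift i j == i]eq_sym (negbTE (neq_lift _ _))/= mulr0 addr0 mxE.
Qed.

(** The Gram matrix changes only in its diagonal entry [i], by
[t ^+ 2 * inner G N N]: the terms linear in [t] pair [N] with the rows of [V].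
Only the quadratic dependence on [t] matters below, not the value of [c]. *)
Lemma det_gram_orthogonal G i V N : G^T = G -> N *m G *m V^T = 0 ->
  exists c, forall t,
    \det (gram G (set_row i (row i V + t *: N) V)) =
    \det (gram G V) + t ^+ 2 * c.
Proof.
move=> Gs NV.
have VN : V *m G *m N^T = 0.
  by apply: trmx_inj; rewrite !trmx_mul trmxK Gs trmx0 mulmxA.
exists (inner G N N * \det (\matrix_(j < p) if j == i then delta_mx 0 i
   else row j (gram G V))) => t.
pose D : 'cV[R]_p := delta_mx i 0.
have -> : set_row i (row i V + t *: N) V = V + t *: (D *m N).
  apply/matrixP => j k; rewrite !mxE big_ord1 !mxE eqxx andbT.
  by case: eqP => [->|_]; rewrite !mxE ?mul1r// mul0r mulr0 addr0.
have -> : gram G (V + t *: (D *m N)) =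
    gram G V + (t ^+ 2 * inner G N N) *: delta_mx i i.
  rewrite /gram [(V + _)^T]raddfD/= [(t *: _)^T]linearZ/= trmx_mul.
  rewrite !mulmxDl !mulmxDr -!scalemxAl -!scalemxAr -!mulmxA.
  have -> : V *m (G *m (N^T *m D^T)) = 0 by rewrite !mulmxA VN mul0mx.
  have -> : D *m (N *m (G *m V^T)) = 0 by rewrite [N *m _]mulmxA NV mulmx0.
  rewrite !scaler0 addr0 add0r.
  rewrite scalerA -expr2 [G *m (N^T *m _)]mulmxA [N *m (_ *m _)]mulmxA.
  rewrite [N *m (G *m _)]mulmxA.
  have -> : N *m G *m N^T = (inner G N N)%:M.
    by apply/matrixP => a b; rewrite !ord1 [RHS]mxE eqxx mulr1n.
  by rewrite mul_scalar_mx -scalemxAr scalerA trmx_delta mul_delta_mx.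
by rewrite det_add_delta mulrA.
Qed.

Lemma multilinear0 w i V : alternating_multilinear w -> w (set_row i 0 V) = 0.
Proof.
move=> [/(_ i 1 0 0 V) + _]; rewrite scaler0 addr0 mul1r => /eqP.
by rewrite addrC -subr_eq subrr eq_sym => /eqP.
Qed.

Lemma multilinear_sum w i V (I : Type) (r : seq I) (a : I -> R)
    (u : I -> 'rV[R]_n) :
  alternating_multilinear w ->
  w (set_row i (\sum_(j <- r) a j *: u j) V) =
  \sum_(j <- r) a j * w (set_row i (u j) V).
Proof.
move=> aw; elim: r => [|j r IH]; first by rewrite !big_nil multilinear0.
by rewrite !big_cons; case: (aw) => ml _; rewrite ml IH.
Qed.

(** Tilting the row [i] of [V] towards [N] by an amount [t] changes the volume
only to order [t ^+ 2], by [det_gram_orthogonal], whereas [w] grows at the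
linear rate [b = w (set_row i N V)].  If [b] were nonzero, a small tilt of the
right sign, rescaled to unit volume, would push [w] above its bound [1]. *)
Lemma first_cousin_principle G w V i N : G^T = G -> alternating_multilinear w ->
  (forall V', unit_simple G V' -> w V' <= 1) ->
  unit_simple G V -> w V = 1 -> N *m G *m V^T = 0 -> w (set_row i N V) = 0.
Proof.
move=> Gs aw le1; rewrite unit_simpleE => V1 wV NV.
have [c detE] := det_gram_orthogonal i Gs NV; rewrite {}V1 in detE.
set b := w _; apply/eqP/negPn/negP => b0.
(* e is small enough for the quadratic terms |c| t^2 and b^2 t^2 at t = e b to
   be dominated by the linear gain b t = e b^2. *)
pose e := (1 + `|c| + b ^+ 2)^-1; pose t := e * b.
have b2 : 0 < b ^+ 2 by rewrite exprn_even_gt0.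
have D0 : 0 < 1 + `|c| + b ^+ 2.
  by rewrite addr_gt0// ltr_pwDl.
have e0 : 0 < e by rewrite invr_gt0.
have eD : e * (1 + `|c| + b ^+ 2) = 1 by rewrite mulVf// gt_eqF.
have [c1 c2] : - `|c| <= c /\ c <= `|c|.
  by rewrite ler_norm; split=> //; rewrite lerNl -normrN ler_norm.
have c0 := normr_ge0 c; move: (`|c|) c0 c1 c2 D0 eD => ac c0 c1 c2 D0 eD.
pose q := 1 + t ^+ 2 * c.
have eb1 : e * b ^+ 2 < 1 by rewrite -eD ltr_pM2l//; lra.
have ec1 : - 1 < e * c by rewrite -eD -mulrN ltr_pM2l//; lra.
have q0 : 0 < q.
  have -> : q = 1 + (e * b ^+ 2) * (e * c) by rewrite /q /t; ring.
  have : 0 < e * b ^+ 2 by rewrite mulr_gt0.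
  move: (e * b ^+ 2) (e * c) eb1 ec1 => x y x1 y1 x0.
  nra.
(* q is the squared volume of the tilted plane; scaling one row by s makes it
   a unit plane again. *)
pose s := (Num.sqrt q)^-1.
have s2 : s ^+ 2 * q = 1.
  by rewrite exprVn sqr_sqrtr ?(ltW q0)// mulVf// gt_eqF.
have s0 : 0 < s by rewrite invr_gt0 sqrtr_gt0.
have /le1 : unit_simple G (set_row i (s *: (row i V + t *: N)) V).
  by rewrite unit_simpleE det_gram_scale detE.
have [ml _] := aw.
rewrite -[s *: _]addr0 ml multilinear0// addr0 addrC ml set_row_row wV -/b.
move=> sle; have : q < (t * b + 1) ^+ 2.
  rewrite /q /t; have : e * c < 2.
    by apply: (@le_lt_trans _ _ 1); [rewrite -eD ler_pM2l//; lra|lra].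
  have : 0 < e * b ^+ 2 by rewrite mulr_gt0.
  rewrite (_ : (e * b) ^+ 2 * c = (e * b ^+ 2) * (e * c)); last by ring.
  rewrite (_ : e * b * b = e * b ^+ 2); last by ring.
  move: (e * b ^+ 2) (e * c) => x y x0 y0; nra.
rewrite ltNge => /negP; apply.
have tb : 0 <= t * b + 1 by rewrite /t -mulrA -expr2 addr_ge0// mulr_ge0// ltW.
rewrite -(ler_pM2l (exprn_gt0 2 s0)) s2 -exprMn.
by rewrite -[leRHS](expr1n _ 2) lerXn2r ?nnegrE ?ler01 ?mulr_ge0// ltW.
Qed.

(** Split [u] into its orthogonal projection [a *m V] on the plane of [V] and a
normal part.  The normal part contributes nothing, by the first cousin
principle; in the slot [i] the tangential part contributes the coefficient
[a 0 i], because [w] is alternating and [w V = 1].  The sum is therefore the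
squared length of the projection. *)
Lemma trace_term_ge0 G w V u : G^T = G -> (forall v, v != 0 -> 0 < inner G v v) ->
  alternating_multilinear w ->
  (forall V', unit_simple G V' -> w V' <= 1) ->
  unit_simple G V -> w V = 1 ->
  0 <= \sum_(i < p) inner G u (row i V) * w (set_row i u V).
Proof.
move=> Gs Gpos aw le1 V1 wV.
have Mu : gram G V \in unitmx.
  by move: V1; rewrite unit_simpleE unitmxE => ->; exact: unitr1.
pose a : 'rV[R]_p := u *m G *m V^T *m invmx (gram G V).
have NV : (u - a *m V) *m G *m V^T = 0.
  rewrite !mulmxBl -!mulmxA [V *m _]mulmxA -/(gram G V) [invmx _ *m _]mulVmx//.
  by rewrite mulmx1 subrr.
have wE i : w (set_row i u V) = a 0 i.
  rewrite -[u in LHS](subrK (a *m V)) -[u - _]scale1r.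
  have [ml alt] := aw; rewrite ml mul1r.
  rewrite (first_cousin_principle i Gs aw le1 V1 wV NV) add0r mulmx_sum_row.
  rewrite multilinear_sum// (bigD1 i)//= set_row_row wV mulr1 big1 ?addr0// => j ji.
  by rewrite (alt i j) ?mulr0 1?eq_sym// !row_set_row eqxx (negbTE ji).
have -> : \sum_(i < p) inner G u (row i V) * w (set_row i u V) =
    inner G (a *m V) (a *m V).
  have -> : inner G (a *m V) (a *m V) = (u *m G *m V^T *m a^T) 0 0.
    rewrite /inner trmx_mul !mulmxA; congr ((_ *m _) 0 0).
    by move/eqP: NV; rewrite !mulmxBl subr_eq0 => /eqP ->.
  by rewrite mxE; apply: eq_bigr => i _; rewrite wE innerE [a^T _ _]mxE.
have [->|/Gpos/ltW//] := eqVneq (a *m V) 0.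
by rewrite /inner mul0mx mul0mx mxE.
Qed.

End LinearAlgebra.

(** * Smooth functions on open sets *)

Section SmoothOn.
Context {R : realType} {V : normedModType R}.
Implicit Types (U B : set V) (f g : V -> R) (k : nat).

Lemma Ck_on_sub k U B f : B `<=` U -> Ck_on k U f -> Ck_on k B f.
Proof.
elim: k f => [|k IH] f BU /=; first by move=> + x /BU; exact.
by move=> [df Df]; split=> [x /BU|v]; [exact: df|exact: IH].
Qed.

Lemma Ck_onS k U f : Ck_on k.+1 U f -> Ck_on k U f.
Proof.
elim: k f => [|k IH] f /= [df Df].
  by move=> x /df; exact: differentiable_continuous.
by split=> // v; apply: IH; exact: Df.
Qed.

(** Differentiability means [f \o shift x = cst (f x) + 'd f x +o_ 0 id], and
both sides of this only see the germ of [f] at [x]. *)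
Lemma near_eq_differentiable f g x :
  {near x, f =1 g} -> differentiable f x -> differentiable g x.
Proof.
move=> fg /diff_locallyP[dfc fo].
have go : g \o shift x = cst (g x) + 'd f x +o_ 0 id.
  apply/eqaddoP => e e0; have /eqaddoP/(_ e e0) := fo.
  have fg0 : \forall h \near (0 : V), f (h + x) = g (h + x).
    by move: fg; rewrite [X in X -> _](near_shift 0) subr0.
  apply: filterS2 fg0 => h fgh; rewrite !fctE /= fgh.
  by rewrite (nbhs_singleton fg).
by apply/diff_locallyP; rewrite (diff_unique dfc go).
Qed.

(** The recursive definition of [Ck_on] constrains the directional derivatives at
the points of [U] only, so a germ of [f] at each point suffices; this is how
rules of calculus, which hold on [U] only, are transported by [eq_Ck_on]. *)
Lemma Ck_on_local k U f :
  (forall x, U x -> exists B g,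
     [/\ open B, B x, Ck_on k B g & forall y, B y -> f y = g y]) ->
  Ck_on k U f.
Proof.
elim: k f => [|k IH] f loc /=.
  move=> x /loc[B [g [oB Bx /(_ _ Bx) cg fg]]].
  have near_fg : {near x, g =1 f}.
    by apply: filterS (open_nbhs_nbhs (conj oB Bx)) => y /fg.
  suff : f @ x --> f x by [].
  rewrite (fg _ Bx); apply: cvg_trans cg.
  exact: near_eq_cvg.
split=> [x /loc[B [g [oB Bx [dg _] fg]]]|v].
  apply: near_eq_differentiable (dg _ Bx).
  by apply: filterS (open_nbhs_nbhs (conj oB Bx)) => y /fg.
apply: IH => x /loc[B [g [oB Bx [dg Dg] fg]]].
exists B, (fun x => 'D_v g x); split=> //; first exact: Dg.
move=> y By; apply: near_eq_derive.
by apply: filterS (open_nbhs_nbhs (conj oB By)) => z /fg.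
Qed.

Lemma eq_Ck_on k U f g : open U -> (forall y, U y -> f y = g y) ->
  Ck_on k U g -> Ck_on k U f.
Proof. by move=> oU fg gk; apply: Ck_on_local => x Ux; exists U, g. Qed.

Lemma Ck_on_cst k U (a : R) : Ck_on k U (fun=> a).
Proof.
elim: k a => [|k IH] a /=; first by move=> x _; exact: cst_continuous.
split=> [x _|v]; first exact: differentiable_cst.
have -> : (fun x => 'D_v (fun=> a) x) = fun=> 0.
  by apply/funext => x; rewrite derive_cst.
exact: IH.
Qed.

Lemma Ck_onD k U f g : open U -> Ck_on k U f -> Ck_on k U g ->
  Ck_on k U (fun x => f x + g x).
Proof.
move=> oU; elim: k f g => [|k IH] f g /=.
  by move=> cf cg x Ux; apply: continuousD; [exact: cf|exact: cg].
move=> [df Df] [dg Dg]; split=> [x Ux|v].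
  by apply: differentiableD; [exact: df|exact: dg].
apply: (@eq_Ck_on _ _ _ (fun x => 'D_v f x + 'D_v g x)) => //; last exact: IH.
by move=> y Uy; rewrite deriveD//; apply: diff_derivable; [exact: df|exact: dg].
Qed.

Lemma Ck_onM k U f g : open U -> Ck_on k U f -> Ck_on k U g ->
  Ck_on k U (fun x => f x * g x).
Proof.
move=> oU; elim: k f g => [|k IH] f g.
  by move=> cf cg x Ux; apply: continuousM; [exact: cf|exact: cg].
move=> /[dup] /Ck_onS fk [df Df] /[dup] /Ck_onS gk [dg Dg]; split=> [x Ux|v].
  by apply: differentiableM; [exact: df|exact: dg].
apply: (@eq_Ck_on _ _ _ (fun x => f x * 'D_v g x + g x * 'D_v f x)) => //.
  by move=> y Uy; rewrite deriveM//; apply: diff_derivable; [exact: df|exact: dg].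
by apply: Ck_onD => //; apply: IH => //; [exact: Dg|exact: Df].
Qed.

Lemma derive_comp_real (h : R -> R) f x v : derivable h (f x) 1 ->
  differentiable f x -> 'D_v (h \o f) x = (h^`())%classic (f x) * 'D_v f x.
Proof.
move=> /derivable1_diffP dh df; rewrite deriveE; last exact: differentiable_comp.
rewrite diff_comp//= [in RHS]deriveE// derive1E' // -[X in 'd _ _ X = _]mulr1.
by rewrite [LHS]linearZ mulrC.
Qed.

Definition smooth_real (h : R -> R) := forall k x, derivable (h^`(k))%classic x 1.

(** By induction on [k] simultaneously for all derivatives [h^`(j)], since the
chain rule turns [h^`(j)] into [h^`(j.+1)]. *)
Lemma Ck_on_comp k U (h : R -> R) f : open U -> smooth_real h ->
  Ck_on k U f -> Ck_on k U (h \o f).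
Proof.
move=> oU hs; rewrite -[h]/((h^`(0))%classic).
elim: k (0%N) f => [|k IH] j f /=.
  move=> cf x Ux; apply: continuous_comp; first exact: cf.
  exact/differentiable_continuous/derivable1_diffP/hs.
move=> /[dup] /Ck_onS fk [df Df]; split=> [x Ux|v].
  by apply: differentiable_comp; [exact: df|exact/derivable1_diffP/hs].
apply: (@eq_Ck_on _ _ _ (fun x => (h^`(j.+1))%classic (f x) * 'D_v f x)) => //.
  by move=> y Uy; rewrite derive_comp_real; [|exact: hs|exact: df].
by apply: Ck_onM; [by []|exact: IH|exact: Df].
Qed.

End SmoothOn.

(** * A smooth convex increasing function vanishing on a half-line *)

Section SmoothHinge.
Context {R : realType}.
Implicit Types (P : {poly R}) (t : R).

(** The functions extending [P(1/t) exp(-1/t)] by zero; they are closed under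
differentiation, which makes all of them smooth. *)
Definition flat P t : R := if 0 < t then P.[t^-1] * expR (- t^-1) else 0.

Definition flat_diff P : {poly R} := 'X^2 * (P - P^`()).

Lemma horner_le_exp P t : 1 <= t ->
  `|P.[t]| <= (\sum_(i < size P) `|P`_i|) * t ^+ size P.
Proof.
move=> t1; rewrite horner_coef mulr_suml.
apply: le_trans (ler_norm_sum _ _ _) _.
apply: ler_sum => i _; rewrite normrM ler_wpM2l// normrX.
rewrite ger0_norm ?(le_trans _ t1)//.
by rewrite ler_weXn2l// ltnW.
Qed.

(** With [s = 1/t], [P(s)] grows at most like [s ^+ d] whereas [expR s] is at
least [s ^+ d.+2 / d.+2`!]; two powers of [t] are left. *)
Lemma flat_near0 P : exists C, forall t, `|t| < 1 -> `|flat P t| <= C * t ^+ 2.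
Proof.
set A := \sum_(i < size P) `|P`_i|; have A0 : 0 <= A by apply: sumr_ge0.
pose d := size P; exists (A * (d.+2)`!%:R) => t.
have F0 : 0 < (d.+2)`!%:R :> R by rewrite ltr0n fact_gt0.
rewrite /flat; case: ifPn => [t0|_ _]; last first.
  by rewrite normr0 mulr_ge0 ?sqr_ge0// mulr_ge0// ltW.
rewrite gtr0_norm// => t1.
have s1 : 1 <= t^-1 by rewrite invf_ge1// ltW.
have s0 : 0 < t^-1 by rewrite invr_gt0.
rewrite normrM [`|expR _|]gtr0_norm ?expR_gt0// expRN.
have le1 : t^-1 ^+ d.+2 / (d.+2)`!%:R <= expR t^-1.
  by apply: le_trans (expR_ge1Dxn d.+1 (ltW s0)); rewrite lerDr.
apply: (@le_trans _ _ (A * t^-1 ^+ d * (t^-1 ^+ d.+2 / (d.+2)`!%:R)^-1)).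
  apply: ler_pM => //; first exact: horner_le_exp.
  by rewrite lef_pV2 ?posrE ?expR_gt0// divr_gt0// exprn_gt0.
rewrite le_eqVlt; apply/orP; left; apply/eqP.
have t00 : t != 0 by rewrite gt_eqF.
rewrite invf_div !exprVn invrK !exprS; field.
by rewrite expf_neq0.
Qed.

(** At [0] the quadratic bound of [flat_near0] forces the derivative to be [0],
which is again a value of [flat]. *)
Lemma is_derive_flat P t : is_derive t 1 (flat P) (flat (flat_diff P) t).
Proof.
have [t0|t0|<-] := ltgtP 0 t.
- have : is_derive t 1 (fun x => P.[x^-1] * expR (- x^-1))
      (flat (flat_diff P) t).
    have t00 : t != 0 by rewrite gt_eqF.
    have dV : is_derive t 1 (fun x : R => x^-1) (- t ^- 2).
      apply: is_derive_eq; first exact: (@is_deriveV _ id).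
      by rewrite [_ *: _]mulr1.
    have dP : is_derive t 1 (fun x => P.[x^-1]) (P^`().[t^-1] * - t ^- 2).
      exact: (is_derive1_comp (is_derive_poly P t^-1) dV).
    have dN : is_derive t 1 (fun x : R => - x^-1) (t ^- 2).
      by rewrite -[t ^- 2]opprK; exact: is_deriveN.
    have dE : is_derive t 1 (fun x => expR (- x^-1)) (expR (- t^-1) * t ^- 2).
      have dE := is_derive_expR (- t^-1).
      exact: (@is_derive1_comp _ expR (fun x => - x^-1) t _ _ dE dN).
    apply: is_derive_eq.
    rewrite /flat t0 /flat_diff !hornerE /= /GRing.scale/= -!exprVn; ring.
  apply: near_eq_is_derive; near=> x.
  by rewrite /flat ifT//; near: x; exact: lt_nbhsr.
- have -> : flat (flat_diff P) t = 0 by rewrite /flat ltNge ltW.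
  have := @is_derive_cst R R R 0 t 1; apply: near_eq_is_derive.
  near=> x; rewrite /flat ifF//; apply/negbTE; rewrite -leNgt ltW//.
  by near: x; exact: lt_nbhsl.
- have [C le] := flat_near0 P.
  have f0 Q : flat Q 0 = 0 by rewrite /flat ltxx.
  have lim0 : h^-1 *: ((flat P \o shift 0) (h *: 1) - flat P 0) @[h --> 0^']
      --> (0 : R).
    apply/cvgrPdist_le => e e0 /=; near=> h.
    have h0 : h != 0 by near: h; exact: nbhs_dnbhs_neq.
    rewrite sub0r normrN f0 subr0 addr0 [h *: 1]mulr1 normrM normfV.
    rewrite ler_pdivrMl ?normr_gt0//.
    apply: (le_trans (le h _)).
      by near: h; exact: dnbhs0_lt.
    rewrite -real_normK ?num_real// expr2 mulrCA ler_wpM2l//.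
    apply: (@le_trans _ _ ((1 + `|C|) * `|h|)).
      by rewrite ler_wpM2r// (le_trans (ler_norm _))// lerDr.
    rewrite mulrC -ler_pdivlMr ?ltr_pwDl//.
    by near: h; apply: dnbhs0_le; rewrite divr_gt0// ltr_pwDl.
  rewrite f0; apply: DeriveDef; last exact: cvg_lim lim0.
  by apply/cvg_ex; exists 0.
Unshelve. all: by end_near. Qed.

Lemma derive1n_flat P k : (flat P)^`(k)%classic = flat (iter k flat_diff P).
Proof.
elim: k => [|k IH]//; rewrite derive1nS IH; apply/funext => t /=.
by rewrite derive1E; have dP := is_derive_flat (iter k flat_diff P) t;
  rewrite derive_val.
Qed.

Lemma smooth_flat P : smooth_real (flat P).
Proof.
move=> k t; rewrite derive1n_flat.
by have [] := is_derive_flat (iter k flat_diff P) t.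
Qed.

Lemma flat_gt0 P t : (forall s, 0 < s -> 0 < P.[s]) -> 0 < t -> 0 < flat P t.
Proof. by move=> P0 t0; rewrite /flat t0 mulr_gt0 ?expR_gt0// P0 ?invr_gt0. Qed.

Lemma flat_ge0 P t : (forall s, 0 < s -> 0 < P.[s]) -> 0 <= flat P t.
Proof.
move=> P0; have [t0|t0] := ltP 0 t; first exact/ltW/flat_gt0.
by rewrite /flat ltNge t0.
Qed.

(** The factor [t] makes the function convex: [exp(-1/t)] alone is not convex
for [t > 1/2], while the second derivative of [t exp(-1/t)] is
[t^-3 exp(-1/t)]. *)
Definition hinge t : R := t * flat 1 t.

Lemma is_derive_hinge t : is_derive t 1 hinge (flat (1 + 'X) t).
Proof.
have d1 := is_derive_flat 1 t.
apply: is_derive_eq; rewrite /GRing.scale/= /flat.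
case: ifP => t0; last by rewrite mulr0 mul0r addr0.
rewrite /flat_diff -polyC1 derivC polyC1 !hornerE /=.
by field; rewrite gt_eqF.
Qed.

Lemma derive1_hinge : hinge^`()%classic = flat (1 + 'X).
Proof.
by apply/funext => t; rewrite derive1E; have d1 := is_derive_hinge t;
  rewrite derive_val.
Qed.

Lemma smooth_hinge : smooth_real hinge.
Proof.
case=> [t|k t]; first by have [] := is_derive_hinge t.
by rewrite derive1Sn derive1_hinge; exact: smooth_flat.
Qed.

Lemma derive1_hinge_ge0 t : 0 <= hinge^`()%classic t.
Proof.
by rewrite derive1_hinge flat_ge0// => s s0; rewrite !hornerE addr_gt0.
Qed.

Lemma derive2_hinge_ge0 t : 0 <= hinge^`()^`()%classic t.
Proof.
rewrite derive1_hinge -[X in X t]/((flat (1 + 'X))^`(1)%classic) derive1n_flat.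
rewrite flat_ge0// => s s0 /=; rewrite /flat_diff derivD derivC derivX !hornerE.
by rewrite addrAC subrr add0r mulr_gt0// exprn_gt0.
Qed.

Lemma hinge_le0 t : t <= 0 -> hinge t = 0.
Proof. by move=> t0; rewrite /hinge /flat ltNge t0 mulr0. Qed.

Lemma hinge_gt0 t : 0 < t -> 0 < hinge t.
Proof.
by move=> t0; rewrite mulr_gt0// flat_gt0// => s _; rewrite hornerE.
Qed.

Lemma hinge_ge0 t : 0 <= hinge t.
Proof. by have [/hinge_le0->|/hinge_gt0/ltW] := leP t 0. Qed.

End SmoothHinge.

Section SmoothRealFunctions.
Context {R : realType}.

Lemma derive1n_cst (a : R) k :
  ((fun=> a)^`(k.+1))%classic = (fun=> 0) :> (R -> R).
Proof.
elim: k => [|k IH]; first by apply/funext => t; exact: derive1_cst.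
by rewrite derive1nS IH; apply/funext => t; exact: derive1_cst.
Qed.

Lemma smooth_real_cst (a : R) : smooth_real (fun=> a).
Proof. by case=> [|k] t; rewrite ?derive1n_cst; exact: derivable_cst. Qed.

Lemma derive1_scale (a : R) : (( *%R a)^`())%classic = (fun=> a).
Proof.
apply/funext => t; rewrite derive1E deriveZ; last exact: derivable_id.
by rewrite derive_id [_ *: _]mulr1.
Qed.

Lemma smooth_real_scale (a : R) : smooth_real ( *%R a).
Proof.
case=> [|k] t; first by apply: derivableZ; exact: derivable_id.
by rewrite derive1Sn derive1_scale; exact: smooth_real_cst.
Qed.

Lemma derive1n_expR k : ((@expR R)^`(k))%classic = expR.
Proof.
elim: k => [|k IH]//; rewrite derive1nS IH; apply/funext => t.
by rewrite derive1E; exact: (congr1 (@^~ t) (@derive_expR R)).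
Qed.

Lemma smooth_real_expR : smooth_real (@expR R).
Proof. by move=> k t; rewrite derive1n_expR; exact: derivable_expR. Qed.

End SmoothRealFunctions.

(** * The Hessian in a chart *)

Section DerivableMatrix.
Context {R : realType} {W : normedModType R}.
Implicit Types (y v : W).

Lemma derivable_sum_seq (I : Type) (r : seq I) (F : I -> W -> R) y v :
  (forall i, derivable (F i) y v) ->
  derivable (fun z => \sum_(i <- r) F i z) y v.
Proof.
move=> dF; elim: r => [|i r IH].
  by under eq_fun do rewrite big_nil; exact: derivable_cst.
under eq_fun do rewrite big_cons.
by apply: derivableD; [exact: dF|exact: IH].
Qed.

Lemma derivable_prod_seq (I : Type) (r : seq I) (F : I -> W -> R) y v :
  (forall i, derivable (F i) y v) ->
  derivable (fun z => \prod_(i <- r) F i z) y v.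
Proof.
move=> dF; elim: r => [|i r IH].
  by under eq_fun do rewrite big_nil; exact: derivable_cst.
under eq_fun do rewrite big_cons.
by apply: derivableM; [exact: dF|exact: IH].
Qed.

Lemma derivable_det m (M : W -> 'M[R]_m) y v :
  (forall i j, derivable (fun z => M z i j) y v) ->
  derivable (fun z => \det (M z)) y v.
Proof.
move=> dM; apply: derivable_sum_seq => s.
apply: derivableM; first exact: derivable_cst.
exact: derivable_prod_seq.
Qed.

(** By Cramer's rule the entries of the inverse are quotients of polynomials in
the entries. *)
Lemma derivable_invmx m (M : W -> 'M[R]_m) y v i j :
  (\forall z \near y, M z \in unitmx) ->
  (forall i j, derivable (fun z => M z i j) y v) ->
  derivable (fun z => invmx (M z) i j) y v.
Proof.
move=> Mu dM.
have : derivable (fun z => (\det (M z))^-1 * cofactor (M z) j i) y v.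
  apply: derivableM; last first.
    apply: derivableM; first exact: derivable_cst.
    by apply: derivable_det => a b; under eq_fun do rewrite !mxE; exact: dM.
  apply: derivableV; last exact: derivable_det.
  by have := nbhs_singleton Mu; rewrite unitmxE unitfE.
apply: near_eq_derivable; apply: filterS Mu => z Mz.
by rewrite /invmx Mz !mxE.
Qed.

Lemma derive_scale_mx m k (a : W -> R) (M : W -> 'M[R]_(m, k)) y v :
  derivable a y v -> derivable M y v ->
  'D_v (fun z => a z *: M z) y = a y *: 'D_v M y + 'D_v a y *: M y.
Proof.
move=> da dM.
have entry i j : derivable (fun z => M z i j) y v.
  exact: ((derivable_mxP _ _ _).1 dM).
have entryE i j : (fun z => (a z *: M z) i j) = a * (fun z => M z i j).
  by apply/funext => z; rewrite mxE.
have daM : derivable (fun z => a z *: M z) y v.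
  apply/derivable_mxP => i j; rewrite entryE.
  exact: (derivableM da (entry i j)).
rewrite (derive_mx dM) (derive_mx daM); apply/matrixP => i j.
rewrite !mxE entryE (deriveM da (entry i j)) /GRing.scale/=.
by congr (_ + _); rewrite mulrC.
Qed.

End DerivableMatrix.

Section LocalHessian.
Context {R : realType} {n p : nat}.
Implicit Types (y v : 'rV[R]_n) (f : 'rV[R]_n -> R) (V : 'M[R]_(p, n)).
Context (U : set 'rV[R]_n) (g : 'rV[R]_n -> 'M[R]_n).
Context (w : 'rV[R]_n -> 'M[R]_(p, n) -> R).
Context (U_open : open U).
Context (g_smooth : forall i j, smooth_on U (fun y => g y i j)).
Context (g_sym : forall y, U y -> (g y)^T = g y).
Context (g_pos : forall y v, U y -> v != 0 -> 0 < inner (g y) v v).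
Context (w_alt : forall y, U y -> alternating_multilinear (w y)).

Lemma near_open y (P : set 'rV[R]_n) : U y -> (forall z, U z -> P z) ->
  \forall z \near y, P z.
Proof. by move=> Uy UP; apply: filterS (open_nbhs_nbhs (conj U_open Uy)). Qed.

Lemma metric_unitmx y : U y -> g y \in unitmx.
Proof.
move=> Uy; rewrite -row_free_unit; apply/inj_row_free => v vg0.
apply/eqP/negPn/negP => /(g_pos Uy).
by rewrite /inner vg0 mul0mx mxE ltxx.
Qed.

Lemma derive_inner_grad f y v : U y -> differentiable f y ->
  'D_v f y = inner (g y) (grad g f y) v.
Proof.
move=> Uy df.
pose d : 'rV[R]_n := \row_l 'D_(vec_e l) f y.
have -> : grad g f y = d *m invmx (g y).
  have gi : (invmx (g y))^T = invmx (g y) by rewrite trmx_inv g_sym.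
  rewrite -gi; apply/rowP => k; rewrite !mxE; apply: eq_bigr => l _.
  by rewrite !mxE mulrC.
rewrite /inner mulmxKV ?metric_unitmx// mxE.
rewrite deriveE// {1}[v]row_sum_delta linear_sum; apply: eq_bigr => l _.
by rewrite linearZ/= !mxE deriveE// mulrC.
Qed.

Lemma derivable_grad f y v : U y -> smooth_on U f -> derivable (grad g f) y v.
Proof.
move=> Uy fs; apply/derivable_mxP => i k.
under eq_fun do rewrite mxE; apply: derivable_sum_seq => l.
apply: derivableM.
  apply: derivable_invmx.
    by apply: near_open => // z; exact: metric_unitmx.
  move=> a b; have [dg _] := g_smooth a b 1.
  exact/diff_derivable/dg.
have [_ /(_ (vec_e l))[df _]] := fs 2.
exact/diff_derivable/df.
Qed.

(** A covariant derivative at a point only involves the value and the ordinary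
derivative of the field there.  With [u = 0] this is additivity, and with [u]
the term in which the scalar factor is differentiated it is the Leibniz rule. *)
Lemma cov_deriv_lin (W W1 W2 : 'rV[R]_n -> 'rV[R]_n)
    (a : R) (u : 'rV[R]_n) y v :
  'D_v W y = a *: 'D_v W1 y + u + 'D_v W2 y -> W y = a *: W1 y + W2 y ->
  cov_deriv g W y v = a *: cov_deriv g W1 y v + u + cov_deriv g W2 y v.
Proof.
move=> DW WE; rewrite /cov_deriv DW scalerDr -!addrA; congr (_ + _).
rewrite [RHS]addrCA; congr (_ + _); rewrite [RHS]addrCA; congr (_ + _).
apply/rowP => k; rewrite !mxE mulr_sumr -big_split; apply: eq_bigr => i _ /=.
rewrite mulr_sumr -big_split; apply: eq_bigr => j _ /=.
by rewrite WE !mxE; ring.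
Qed.

Lemma near_eq_hessian f1 f2 y V : {near y, f1 =1 f2} ->
  local_phi_hessian g w f1 y V = local_phi_hessian g w f2 y V.
Proof.
move=> f12; have gradE : {near y, grad g f1 =1 grad g f2}.
  apply: filterS (near_join f12) => z f12z; apply/rowP => k; rewrite !mxE.
  by apply: eq_bigr => l _; congr (_ * _); exact: near_eq_derive.
apply: eq_bigr => i _; suff -> : cov_deriv g (grad g f1) y (row i V) =
  cov_deriv g (grad g f2) y (row i V) by [].
rewrite /cov_deriv (near_eq_derive _ gradE); congr (_ + _).
apply/rowP => k; rewrite !mxE; apply: eq_bigr => a _; apply: eq_bigr => b _.
by rewrite (nbhs_singleton gradE).
Qed.

Lemma hessianD f1 f2 y V : U y -> smooth_on U f1 -> smooth_on U f2 ->
  local_phi_hessian g w (fun z => f1 z + f2 z) y V =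
  local_phi_hessian g w f1 y V + local_phi_hessian g w f2 y V.
Proof.
move=> Uy s1 s2; rewrite /local_phi_hessian -big_split; apply: eq_bigr => i _ /=.
have gradE z : U z ->
    grad g (fun z => f1 z + f2 z) z = grad g f1 z + grad g f2 z.
  move=> Uz; apply/rowP => k; rewrite !mxE -big_split; apply: eq_bigr => l _ /=.
  have [d1 _] := s1 1; have [d2 _] := s2 1.
  by rewrite deriveD ?mulrDr//; apply: diff_derivable; [exact: d1|exact: d2].
rewrite (@cov_deriv_lin _ (grad g f1) (grad g f2) 1 0) ?scale1r ?gradE//;
  last first.
  rewrite addr0 -deriveD; [|exact: derivable_grad|exact: derivable_grad].
  by apply: near_eq_derive; exact: near_open.
by have [ml _] := w_alt Uy; rewrite addr0 -[X in X + _]scale1r ml mul1r.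
Qed.

(** The gradient of [h \o f] is [h'(f)] times that of [f], and differentiating
the factor along [v] gives [h''(f) * 'D_v f], where ['D_v f] is the inner
product of [v] with the gradient of [f]. *)
Lemma hessian_comp (h : R -> R) f y V : U y -> smooth_on U f -> smooth_real h ->
  local_phi_hessian g w (h \o f) y V =
  (h^`())%classic (f y) * local_phi_hessian g w f y V +
  (h^`(2))%classic (f y) *
    \sum_(i < p) inner (g y) (grad g f y) (row i V) *
      w y (set_row i (grad g f y) V).
Proof.
move=> Uy fs hs; rewrite /local_phi_hessian !mulr_sumr -big_split/=.
apply: eq_bigr => i _.
have [df _] := fs 1.
have gradE z : U z -> grad g (h \o f) z = (h^`())%classic (f z) *: grad g f z.
  move=> Uz; apply/rowP => k; rewrite !mxE mulr_sumr; apply: eq_bigr => l _ /=.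
  by rewrite (derive_comp_real _ (hs 0 (f z)) (df z Uz)) mulrCA.
have dh : derivable ((h^`())%classic \o f) y (row i V).
  apply/diff_derivable/differentiable_comp; first exact: df.
  exact/derivable1_diffP/(hs 1).
have dG : derivable (grad g f) y (row i V) by exact: derivable_grad.
have DG : 'D_(row i V) (grad g (h \o f)) y =
    (h^`())%classic (f y) *: 'D_(row i V) (grad g f) y +
    ((h^`(2))%classic (f y) * 'D_(row i V) f y) *: grad g f y.
  transitivity ('D_(row i V) (fun z => (h^`())%classic (f z) *: grad g f z) y).
    by apply: near_eq_derive; exact: near_open.
  rewrite (derive_scale_mx dh dG) (derive_comp_real _ (hs 1 (f y)) (df y Uy)).
  by [].
rewrite (@cov_deriv_lin _ (grad g f) (fun=> 0) ((h^`())%classic (f y))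
  (((h^`(2))%classic (f y) * 'D_(row i V) f y) *: grad g f y)); first last.
- by rewrite gradE// addr0.
- by rewrite DG derive_cst addr0.
have -> : cov_deriv g (fun=> 0) y (row i V) = 0 :> 'rV[R]_n.
  rewrite /cov_deriv derive_cst add0r; apply/rowP => k; rewrite !mxE.
  rewrite big1// => a _; rewrite big1// => b _.
  by rewrite [X in _ * X](_ : _ = 0) ?mulr0 ?mxE.
have [ml _] := w_alt Uy; rewrite addr0 ml; congr (_ + _).
rewrite -[_ *: grad g f y]addr0 ml multilinear0 ?addr0; last exact: w_alt.
by rewrite (derive_inner_grad _ Uy) ?mulrA//; exact: df.
Qed.

End LocalHessian.

(** * Plurisubharmonic functions on the manifold *)

Section ChartTopology.
Context {R : realType} {n : nat} {X : topologicalType}.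
Implicit Types (c : chart R n X) (B : set X) (x : X).

Lemma chart_im_mem c x : chart_dom c x -> chart_im c (c x).
Proof. by exists x. Qed.

Lemma chart_inv_cvg c x : chart_dom c x -> chart_inv c z @[z --> c x] --> x.
Proof.
move=> cx; have := @chart_inv_cont _ _ _ c.
rewrite continuous_open_subspace; last exact: chart_im_open.
by move=> /(_ (c x)); rewrite inE /continuous_at chart_mapK//; apply; exists x.
Qed.

Lemma chart_map_cvg c x : chart_dom c x -> c z @[z --> x] --> c x.
Proof.
move=> cx; have := @chart_map_cont _ _ _ c.
rewrite continuous_open_subspace; last exact: chart_dom_open.
by apply; rewrite inE.
Qed.

Lemma near_chart_inv c x B : chart_dom c x -> nbhs x B ->
  \forall z \near c x, B (chart_inv c z).
Proof. by move=> cx; exact: chart_inv_cvg. Qed.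

End ChartTopology.

Section Plurisubharmonic.
Context {R : realType} {n p : nat} {X : calibrated_manifold R n p}.
Implicit Types (f : X -> R) (h : R -> R) (c : chart R n X).

Lemma hessianD_at f1 f2 c x V : atlas c -> chart_dom c x ->
  smooth_fun f1 -> smooth_fun f2 ->
  phi_hessian (fun x => f1 x + f2 x) c x V =
  phi_hessian f1 c x V + phi_hessian f2 c x V.
Proof.
move=> cA cx s1 s2; rewrite /phi_hessian.
apply: (hessianD (U := chart_im c)).
- exact: chart_im_open.
- by move=> i j; exact: metric_smooth.
- by move=> y v; exact: metric_pos.
- by move=> y; exact: calib_alt.
- exact: chart_im_mem.
- exact: s1.
- exact: s2.
Qed.

(** On a plane calibrated by the form, the term carrying the second derivative of
[h] is a squared length, by [trace_term_ge0]; hence convex increasing functions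
of plurisubharmonic functions are plurisubharmonic. *)
Lemma hessian_comp_at f h c x V : atlas c -> chart_dom c x ->
  phi_plane c x V -> smooth_fun f -> smooth_real h ->
  exists2 q, 0 <= q & phi_hessian (h \o f) c x V =
    (h^`())%classic (f x) * phi_hessian f c x V + (h^`(2))%classic (f x) * q.
Proof.
move=> cA cx [V1 wV] fs hs; have cU := chart_im_mem cx.
have H := hessian_comp (@chart_im_open _ _ _ c)
  (fun i j => @metric_smooth _ _ X c i j cA)
  (fun y => @Defs.metric_sym _ _ X c y cA)
  (fun y v => @metric_pos _ _ X c y v cA)
  (fun y => @calib_alt _ _ _ X c y cA) V cU (fs c cA) hs.
rewrite /= chart_mapK// in H; eexists; last exact: H.
apply: trace_term_ge0 => //.
- exact: Defs.metric_sym.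
- by move=> v; exact: metric_pos.
- exact: calib_alt.
- by move=> V'; exact: calib_le1.
Qed.

Lemma smooth_fun_comp f h :
  smooth_real h -> smooth_fun f -> smooth_fun (h \o f).
Proof.
move=> hs fs c cA k; apply: (Ck_on_comp (f := f \o chart_inv c)) => //.
  exact: chart_im_open.
exact: fs.
Qed.

Lemma smooth_funD f1 f2 : smooth_fun f1 -> smooth_fun f2 ->
  smooth_fun (fun x => f1 x + f2 x).
Proof.
move=> s1 s2 c cA k; apply: (Ck_onD (f := f1 \o chart_inv c)).
- exact: chart_im_open.
- exact: s1.
- exact: (s2 c cA k).
Qed.

Lemma strictly_phi_psh_psh f : strictly_phi_psh f -> phi_psh f.
Proof. by move=> [fs f0]; split=> // c x V cA cx /(f0 c x V cA cx)/ltW. Qed.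

Lemma phi_psh_comp f h : smooth_real h ->
  (forall t, 0 <= (h^`())%classic t) -> (forall t, 0 <= (h^`(2))%classic t) ->
  phi_psh f -> phi_psh (h \o f).
Proof.
move=> hs h1 h2 [fs f0].
split=> [|c x V cA cx xV]; first exact: smooth_fun_comp.
have [q q0 ->] := hessian_comp_at cA cx xV fs hs.
by rewrite addr_ge0// mulr_ge0// f0.
Qed.

Lemma strictly_phi_psh_comp f h : smooth_real h ->
  (forall t, 0 < (h^`())%classic t) -> (forall t, 0 <= (h^`(2))%classic t) ->
  strictly_phi_psh f -> strictly_phi_psh (h \o f).
Proof.
move=> hs h1 h2 [fs f0].
split=> [|c x V cA cx xV]; first exact: smooth_fun_comp.
have [q q0 ->] := hessian_comp_at cA cx xV fs hs.
by rewrite ltr_pwDl// ?mulr_ge0// mulr_gt0// f0.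
Qed.

Lemma phi_pshD f1 f2 : phi_psh f1 -> phi_psh f2 ->
  phi_psh (fun x => f1 x + f2 x).
Proof.
move=> [s1 p1] [s2 p2]; split=> [|c x V cA cx xV]; first exact: smooth_funD.
rewrite (hessianD_at V cA cx s1 s2).
by apply: addr_ge0; [exact: p1|exact: p2].
Qed.

Lemma strictly_phi_pshD f1 f2 : phi_psh f1 -> strictly_phi_psh f2 ->
  strictly_phi_psh (fun x => f1 x + f2 x).
Proof.
move=> [s1 p1] [s2 p2]; split=> [|c x V cA cx xV]; first exact: smooth_funD.
rewrite (hessianD_at V cA cx s1 s2).
by apply: ltr_wpDl; [exact: p1|exact: p2].
Qed.

(** This is what allows locally finite sums of plurisubharmonic functions. *)
Lemma phi_psh_local f :
  (forall x : X, exists2 h, phi_psh h & {near x, f =1 h}) -> phi_psh f.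
Proof.
move=> loc; split=> [c cA k|c x V cA cx xV].
  apply: Ck_on_local => y [x cx <-].
  have [h [hs _] fh] := loc x.
  have : nbhs (c x)
      [set z | chart_im c z /\ f (chart_inv c z) = h (chart_inv c z)].
    apply: filterI; last exact: near_chart_inv fh.
    by apply: open_nbhs_nbhs; split; [exact: chart_im_open|exact: chart_im_mem].
  rewrite nbhsE => -[B [oB Bx] BE].
  exists B, (h \o chart_inv c); split=> //; last by move=> z /BE[].
  by apply: Ck_on_sub (hs c cA k) => z /BE[].
have [h [hs h0] fh] := loc x.
rewrite /phi_hessian (@near_eq_hessian _ _ _ _ _ _ (h \o chart_inv c)).
  exact: h0.
exact: near_chart_inv fh.
Qed.

Lemma smooth_fun_continuous f : smooth_fun f -> continuous f.
Proof.
move=> fs x; have [c cA cx] := atlas_cover x.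
have fc : f (chart_inv c z) @[z --> c x] --> f x.
  have := fs c cA 0 (c x) (chart_im_mem cx).
  by rewrite /= /prop_for /continuous_at /= chart_mapK.
have : f (chart_inv c (c z)) @[z --> x] --> f x.
  exact: (cvg_comp _ _ (chart_map_cvg cx) fc).
apply: cvg_trans; apply: near_eq_cvg.
have : nbhs x (chart_dom c).
  by apply: open_nbhs_nbhs; split => //; exact: chart_dom_open.
by apply: filterS => z cz; rewrite chart_mapK.
Qed.

End Plurisubharmonic.

(** * Compact sets in the manifold *)

Section ManifoldTopology.
Context {R : realType} {n : nat} {X : smooth_manifold R n}.
Implicit Types (A B K : set X) (x : X).

Lemma manifold_compact_nbhs x : exists2 K, compact K & nbhs x K.
Proof.
have [c _ cx] := atlas_cover x.
have /nbhs_ballP[e /= e0 be] : nbhs (c x) (chart_im c).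
  by apply: open_nbhs_nbhs; split; [exact: chart_im_open|exact: chart_im_mem].
pose D := closed_ball (c x) (e / 2).
have Dim : D `<=` chart_im c.
  apply: subset_trans be; apply: closed_ball_subset; rewrite ?divr_gt0//.
  by rewrite ltr_pdivrMr// ltr_pMr// ltr1n.
exists (chart_inv c @` D).
  apply: continuous_compact.
    exact: continuous_subspaceW Dim (@chart_inv_cont _ _ _ c).
  apply: bounded_closed_compact; last exact: closed_ball_closed.
  exists (`|c x| + e / 2); split=> [|M cM z]; first exact: num_real.
  rewrite /D closed_ballE ?divr_gt0// /closed_ball_/= => cz.
  apply: le_trans (ltW cM); rewrite -[z](subKr (c x)).
  by rewrite (le_trans (ler_normB _ _))// lerD2l.
have Dx : nbhs (c x) D.
  apply: filterS (nbhsx_ballx (c x) (e / 2) _); first exact: subset_closed_ball.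
  by rewrite divr_gt0.
have domx : nbhs x (chart_dom c).
  by apply: open_nbhs_nbhs; split=> //; exact: chart_dom_open.
apply: filterS2 domx (chart_map_cvg cx Dx) => z cz Dz.
by exists (c z); rewrite ?chart_mapK.
Qed.

(** Finite sequences of points are filtered by inclusion, and a point [y] near [x]
is covered by every sequence that contains [x]; the near-covering form of
compactness then gives one sequence for the whole of [A]. *)
Lemma compact_local_cover A (F : X -> set X) : compact A ->
  (forall x, A x -> nbhs x (F x)) ->
  exists s : seq X, forall y, A y -> exists2 x, x \in s & (F x)° y.
Proof.
move=> /compact_near_coveringP cA AF.
pose G := filter_from setT
  (fun s0 : seq X => [set s : seq X | {subset s0 <= s}]).
have GF : Filter G.
  apply: filter_from_filter; first by exists [::].
  move=> s1 s2 _ _; exists (s1 ++ s2) => // s sub; split=> z zs; apply: sub;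
    by rewrite mem_cat zs ?orbT.
have [] := cA _ G (fun s y => exists2 x, x \in s & (F x)° y) GF.
  move=> x Ax; exists ((F x)°, [set s : seq X | x \in s]).
    split; first exact/nbhs_interior/AF.
    by exists [:: x] => // s; apply; rewrite mem_head.
  by case=> y s [/= Fy xs]; exists x.
by move=> s _ /(_ s (fun _ => id)) sub; exists s.
Qed.

Lemma compact_compact_nbhs A : compact A -> exists2 K, compact K & A `<=` K°.
Proof.
move=> cA; have exF x : exists K, compact K /\ nbhs x K.
  by have [K cK Kx] := manifold_compact_nbhs x; exists K.
have [F FP] := choice exF.
have [s cov] := compact_local_cover cA (fun x _ => (FP x).2).
exists (\big[setU/set0]_(x <- s) F x).
  by apply: bigsetU_compact => x _; have [] := FP x.
move=> y /cov[x xs]; apply: interiorS => z Fz; rewrite -bigcup_seq.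
by exists x.
Qed.

(** The members of a countable basis with compact closure already cover, because
every point has a compact neighbourhood. *)
Lemma manifold_sigma_compact : exists2 C : nat -> set X,
  (forall m, compact (C m)) & forall x, exists m, C m x.
Proof.
have [B /countable_injP[f finj] [oB basisB]] := @carrier_second_countable _ _ X.
exists (fun m => [set y |
  exists b, [/\ B b, f b = m, compact (closure b) & closure b y]]).
  move=> m; have [[b [Bb fb cb]]|nb] :=
      pselect (exists b, [/\ B b, f b = m & compact (closure b)]).
    rewrite (_ : mkset _ = closure b)// eqEsubset; split=> y; last by exists b.
    move=> [b' [Bb' fb' _]]; suff -> : b' = b by [].
    by apply: finj; rewrite ?inE// fb' fb.
  rewrite (_ : mkset _ = set0); first exact: compact0.
  by rewrite -subset0 => y [b [Bb fb cb _]]; apply: nb; exists b.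
move=> x; have [K cK Kx] := manifold_compact_nbhs x.
have [b [Bb bx] bK] := basisB x K Kx.
exists (f b), b; split=> //; last exact: subset_closure.
apply: (subclosed_compact _ cK); first exact: closed_closure.
have Kcl : closed K by apply: compact_closed => //; exact: carrier_hausdorff.
by rewrite [K](closure_id K).1//; exact: closureS.
Qed.

End ManifoldTopology.

(** * Exhausting the manifold *)

Section Exhaustion.
Context {R : realType} {n p : nat} {X : calibrated_manifold R n p}.
Implicit Types (f : X -> R) (K L : set X) (x : X).

Lemma closed_sublevel f (r : R) : smooth_fun f -> closed [set x | f x <= r].
Proof.
move=> fs; apply: (@preimage_closed _ _ f [set t | t <= r]).
  by move=> x _; exact: smooth_fun_continuous.
exact: closed_le.
Qed.

(** A constant function is its own composite with a constant, and [hessian_comp_at]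
then gives a vanishing Hessian. *)
Lemma phi_psh_cst (a : R) : phi_psh (fun _ : X => a).
Proof.
have s : smooth_fun (fun _ : X => a).
  by move=> c cA k; exact: Ck_on_cst.
split=> // c x V cA cx xV.
have [q q0] := hessian_comp_at cA cx xV s (@smooth_real_cst R a).
rewrite -[(fun=> a) \o _]/(fun _ : X => a) => ->.
by rewrite -derive1n1 !derive1n_cst !mul0r addr0.
Qed.

Lemma phi_psh_scale f (a : R) :
  0 <= a -> phi_psh f -> phi_psh (fun x => a * f x).
Proof.
move=> a0; apply: (phi_psh_comp (h := *%R a)); first exact: smooth_real_scale.
  by move=> t; rewrite derive1_scale.
by move=> t; rewrite derive1nS derive1n1 derive1_scale derive1_cst.
Qed.

Lemma phi_psh_sum (I : Type) (r : seq I) (F : I -> X -> R) :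
  (forall i, phi_psh (F i)) -> phi_psh (fun x => \sum_(i <- r) F i x).
Proof.
move=> FP; elim: r => [|i r IH].
  by under eq_fun do rewrite big_nil; exact: phi_psh_cst.
under eq_fun do rewrite big_cons.
by apply: phi_pshD; [exact: FP|exact: IH].
Qed.

Lemma sub_phi_hull K : K `<=` phi_hull K.
Proof. by move=> x Kx f _; apply: ereal_sup_ubound; exists x. Qed.

Lemma phi_hull_sublevel f K (r : R) : phi_psh f -> K `<=` [set x | f x <= r] ->
  phi_hull K `<=` [set x | f x <= r].
Proof.
move=> fp Kr x /(_ f fp) le; rewrite /= -lee_fin (le_trans le)//.
by apply: ge_ereal_sup => _ [y /Kr /= yr <-]; rewrite lee_fin.
Qed.

(** A function [f] violating the hull inequality at [x] lies below some [r < f x]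
on [K]; composing [f - r] with [hinge] makes it vanish on [K], and scaling makes
it large at [x]. *)
Lemma psh_bump K x (M : R) : ~ phi_hull K x ->
  exists2 f, phi_psh f &
    [/\ forall y, 0 <= f y, forall y, K y -> f y = 0 & M < f x].
Proof.
move=> /existsNP[f /not_implyP[fp /negP]]; rewrite -ltNge => supx.
have [r Kr rx] : exists2 r : R, (forall y, K y -> f y <= r) & r < f x.
  case E : (ereal_sup _) supx => [r| |]// supx.
    exists r => // y Ky; rewrite -lee_fin -E.
    by apply: ereal_sup_ubound; exists y.
  (* The supremum is -oo when K is empty: any r below f x will do. *)
  exists (f x - 1) => [y Ky|]; last by rewrite gtrBl.
  have : ((f y)%:E <= -oo)%E by rewrite -E; apply: ereal_sup_ubound; exists y.
  by rewrite leeNy_eq.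
have c0 : 0 < hinge (f x + - r) by rewrite hinge_gt0// subr_gt0.
exists (fun y => (`|M| + 1) / hinge (f x + - r) * hinge (f y + - r)).
  apply: phi_psh_scale; first by rewrite divr_ge0// ?ltW// addr_ge0.
  apply: (phi_psh_comp (h := hinge) (f := fun y => f y + - r)).
  - exact: smooth_hinge.
  - exact: derive1_hinge_ge0.
  - exact: derive2_hinge_ge0.
  - by apply: phi_pshD; [exact: fp|exact: phi_psh_cst].
split=> [y|y Ky|].
- by rewrite mulr_ge0 ?hinge_ge0// divr_ge0// ?ltW// addr_ge0.
- by rewrite [hinge (f y - r)]hinge_le0 ?mulr0// subr_le0 Kr.
- by rewrite divfK ?gt_eqF// (le_lt_trans (ler_norm M))// ltrDl.
Qed.

Lemma psh_bump_compact K L (M : R) : 0 <= M -> compact L ->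
  (forall x, L x -> ~ phi_hull K x) ->
  exists2 f, phi_psh f &
    [/\ forall y, 0 <= f y, forall y, K y -> f y = 0 &
        forall x, L x -> M < f x].
Proof.
move=> M0 cL LK.
have exF x : exists f : X -> R, [/\ phi_psh f,
    forall y, 0 <= f y, forall y, K y -> f y = 0 & L x -> M < f x].
  have [Lx|nL] := pselect (L x).
    by have [f fp [f0 fK fx]] := psh_bump M (LK x Lx); exists f.
  by exists (fun=> 0); split=> //; exact: phi_psh_cst.
have [F FP] := choice exF.
have Fnbhs x : L x -> nbhs x [set y | M < F x y].
  move=> Lx; have [[Fs _] _ _ /(_ Lx) Mx] := FP x.
  have cF : F x z @[z --> x] --> F x x := @smooth_fun_continuous _ _ _ _ _ Fs x.
  exact: (cF [set t | M < t] (lt_nbhsr Mx)).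
have [s cov] := compact_local_cover cL Fnbhs.
exists (fun y => \sum_(x <- s) F x y).
  by apply: phi_psh_sum => x; have [] := FP x.
split=> [y|y Ky|y /cov[x xs /interior_subset /= Mx]].
- by apply: sumr_ge0 => x _; have [] := FP x.
- by apply: big1 => x _; have [_ _ + _] := FP x; exact.
- rewrite (big_rem x)//= (lt_le_trans Mx)// lerDl sumr_ge0// => z _.
  by have [] := FP z.
Qed.

(** Each [K m.+1] is a compact neighbourhood of the closed hull of [K m] and of
the next piece of a countable compact cover. *)
Lemma phi_convex_exhaustion :
  (forall K, compact K -> relatively_compact (phi_hull K)) ->
  exists K : nat -> set X, [/\ forall m, compact (K m),
    forall m, phi_hull (K m) `<=` (K m.+1)° & forall x, exists m, K m x].
Proof.
move=> hullc; have [C cC Ccov] := @manifold_sigma_compact _ _ X.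
have exN A : exists K, compact A -> compact K /\ A `<=` K°.
  have [cA|nA] := pselect (compact A); last by exists set0.
  by have [K cK AK] := compact_compact_nbhs cA; exists K.
have [N NP] := choice exN.
pose K := fix K m :=
  if m is m'.+1 then N (closure (phi_hull (K m')) `|` C m') else set0.
have cK m : compact (K m) /\ compact (closure (phi_hull (K m)) `|` C m).
  elim: m => [|m [_ IH]]; (split; [|apply: compactU => //; apply: hullc]);
    by [exact: compact0 | exact: (NP _ IH).1].
exists K; split=> [m|m|x]; first by have [] := cK m.
  apply: subset_trans (NP _ (cK m).2).2; apply: subset_trans (@subsetUl _ _ _).
  exact: subset_closure.
have [m Cx] := Ccov x; exists m.+1.
by apply: interior_subset; apply: (NP _ (cK m).2).2; right.
Qed.

Lemma sum_stable (K : nat -> set X) (f : nat -> X -> R) x a b :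
  (forall m, K m `<=` K m.+1) -> (forall m y, K m y -> f m y = 0) ->
  K a x -> K b x -> \sum_(0 <= m < a) f m x = \sum_(0 <= m < b) f m x.
Proof.
move=> KS fK; wlog ab : a b / (a <= b)%N.
  move=> W Ka Kb; have [/W|/ltnW/W] := leqP a b; first exact.
  by move=> <-.
move=> Ka _; rewrite (big_cat_nat (leq0n a) ab)/= [X in _ = _ + X]big_nat_cond.
rewrite [X in _ = _ + X]big1 ?addr0// => m; rewrite andbT => /andP[am _].
apply: fK; elim: m am => [|m IH]; first by rewrite leqn0 => /eqP <-.
by rewrite leq_eqVlt => /orP[/eqP <-//|/IH]; exact: KS.
Qed.

(** Sum functions [f m] vanishing on [K m] and exceeding [m] on the shell between
[K m.+1] and [K m.+2].  The sum is locally finite because the interiors of the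
[K m] cover, and outside [K m.+1] it exceeds [m], because every point outside lies
in a shell of index at least [m]. *)
Lemma psh_of_compact_hulls :
  (forall K, compact K -> relatively_compact (phi_hull K)) ->
  exists2 u : X -> R, phi_psh u &
    forall r : R, exists2 K, compact K & forall x, u x <= r -> K x.
Proof.
move=> hullc; have [K [cK Khull Kcov]] := phi_convex_exhaustion hullc.
have KS m : K m `<=` K m.+1.
  by move=> x /sub_phi_hull /Khull /interior_subset.
have exf m : exists f : X -> R, [/\ phi_psh f,
    forall y, 0 <= f y, forall y, K m y -> f y = 0 &
    forall x, K m.+2 x -> ~ K m.+1 x -> m%:R < f x].
  have cL : compact (K m.+2 `&` ~` (K m.+1)°).
    by apply: compact_closedI => //; apply: open_closedC; exact: open_interior.
  have LK x : (K m.+2 `&` ~` (K m.+1)°) x -> ~ phi_hull (K m) x.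
    by move=> [_ nK] /Khull.
  have [h hp [h0 hK hL]] := psh_bump_compact (ler0n _ m) cL LK.
  exists h; split=> // x K2 nK1; apply: hL; split=> // /interior_subset.
  exact: nK1.
have [f fP] := choice exf.
have fK m y : K m y -> f m y = 0 by have [_ _ + _] := fP m; exact.
have f0 m y : 0 <= f m y by have [] := fP m.
have [N NP] := choice Kcov.
pose u x := \sum_(0 <= m < N x) f m x.
have uE m x : K m x -> u x = \sum_(0 <= i < m) f i x.
  by move=> Kx; exact: (sum_stable KS fK (NP x) Kx).
exists u.
  apply: phi_psh_local => x; exists (fun y => \sum_(0 <= i < (N x).+1) f i y).
    by apply: phi_psh_sum => m; have [] := fP m.
  have Kx : nbhs x (K (N x).+1) by exact/Khull/sub_phi_hull/NP.
  by apply: filterS Kx => y /uE.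
move=> r; pose M := Num.bound `|r|.
exists (K M.+1) => // x uxr; apply: contrapT => nKx.
have /asboolP KN := NP x.
case: (ex_minnP (ex_intro (fun m => `[< K m x >]) _ KN)) => j /asboolP Kj jmin.
have Mj : (M.+1 < j)%N.
  rewrite ltnNge; apply/negP => jM; apply: nKx.
  elim: (M.+1) jM => [|i IH]; first by rewrite leqn0 => /eqP <-.
  by rewrite leq_eqVlt => /orP[/eqP <-//|/IH]; exact: KS.
case: j Kj jmin Mj => [|[|m]]// Kj jmin; rewrite !ltnS => Mm.
have nKm : ~ K m.+1 x by move=> /asboolP/jmin; rewrite ltnn.
have : r < u x.
  have [_ _ _ /(_ x Kj nKm) mf] := fP m.
  rewrite (uE _ _ Kj) (le_lt_trans (ler_norm r))//.
  apply: (lt_le_trans (archi_boundP (normr_ge0 r))).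
  apply: (@le_trans _ _ m%:R); first by rewrite ler_nat.
  rewrite (le_trans (ltW mf))// !big_nat_recr//= -addrA ler_wpDl ?sumr_ge0//.
  by rewrite lerDl.
by rewrite ltNge uxr.
Qed.

End Exhaustion.

Theorem theorem3p6 (R : realType) (n p : nat) (hp : (1 <= p)%N)
    (X : calibrated_manifold R n p)
    (noncompact : ~ compact [set: X]) (conn : connected [set: X]) :
  ((forall K : set X, compact K -> relatively_compact (phi_hull K)) /\
   (exists f : X -> R, strictly_phi_psh f))
  <->
  (exists f : X -> R, strictly_phi_psh f /\ proper_exhaustion f).
Proof.
split=> [[hullc [g gs]]|[f [fs fproper]]].
  have [u up usub] := psh_of_compact_hulls hullc.
  pose F x := u x + (@expR R \o g) x.
  have Fs : strictly_phi_psh F.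
    apply: strictly_phi_pshD; first exact: up.
    apply: strictly_phi_psh_comp; last exact: gs.
    - exact: smooth_real_expR.
    - by move=> t; rewrite -derive1n1 derive1n_expR expR_gt0.
    - by move=> t; rewrite derive1n_expR expR_ge0.
  exists F; split=> // r; have [K cK uK] := usub r.
  apply: (subclosed_compact _ cK).
    exact: closed_sublevel Fs.1.
  by move=> x /= Fr; apply: uK; rewrite (le_trans _ Fr)// lerDl expR_ge0.
split; last by exists f.
move=> K cK; have [r Kr] : exists r, K `<=` [set x | f x <= r].
  have [->|/set0P K0] := eqVneq K set0; first by exists 0.
  have [|c _ cmax] := compact_EVT_max K0 cK (f := f).
    apply: continuous_subspaceT => x.
    exact: (@smooth_fun_continuous _ _ _ _ _ fs.1).
  by exists (f c) => x Kx; apply: cmax; rewrite inE.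
apply: (subclosed_compact _ (fproper r)); first exact: closed_closure.
rewrite [X in _ `<=` X](closure_id _).1; last exact: closed_sublevel fs.1.
exact/closureS/phi_hull_sublevel/Kr/strictly_phi_psh_psh.
Qed.
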